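(* Let $A,B\in\mathbb{R}^{n\times n}$. Let $\tilde s$ be the orthogonal projection of $s\in\mathbb{R}^n$ onto $\ker(B-A)^{\perp}$ (with respect to the standard Euclidean inner product), and assume $\tilde s\ne0$. Then $$\frac{\|(B-A)s\|_2^2}{\|s\|_2^2}\le\frac{\|(B-A)\tilde s\|_2^2}{\|\tilde s\|_2^2},$$ with equality if and only if $s\in\ker(B-A)^{\perp}$. *)

(* Defs.v *)
From HB Require Import structures.
From mathcomp Require Import all_boot all_order all_algebra sesquilinear.

Set Implicit Arguments.
Unset Strict Implicit.
Unset Printing Implicit Defensive.

Import Order.TTheory GRing.Theory Num.Theory.
Local Open Scope ring_scope.

Definition dotcv (R : realFieldType) (n : nat) (u v : 'cV[R]_n) : R :=
  \sum_(i < n) u i 0 * v i 0.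

Section DotInstance.
Variables (R : realFieldType) (n : nat).

Fact dotcv_bilinear :
  bilinear_for ( *%R) (idfun \; *%R) (@dotcv R n : 'cV[R]_n -> 'cV[R]_n -> R).
Proof.
split=> [v a u1 u2 | u a v1 v2]; rewrite /dotcv /= mulr_sumr -big_split /=;
  apply: eq_bigr => i _; rewrite !mxE ?mulrDl ?mulrDr ?mulrA //.
by rewrite [u i 0 * a]mulrC.
Qed.

HB.instance Definition _ :=
  bilinear_isBilinear.Build R _ _ _ _ _ (@dotcv R n) dotcv_bilinear.

Fact dotcv_hermitian (u v : 'cV[R]_n) :
  dotcv u v = (-1) ^+ false * idfun (dotcv v u).
Proof. by rewrite mul1r; apply: eq_bigr => i _; rewrite mulrC. Qed.

HB.instance Definition _ :=
  isHermitianSesquilinear.Build R _ false idfun (@dotcv R n) dotcv_hermitian.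

Fact dotcv_gt0 (u : 'cV[R]_n) : u != 0 -> 0 < dotcv u u.
Proof.
move=> u0; have ge0 i : true -> 0 <= u i 0 * u i 0 by rewrite -expr2 sqr_ge0.
rewrite lt_def sumr_ge0 // andbT; apply: contraNneq u0.
move/psumr_eq0P=> /(_ ge0) uu0; apply/eqP/colP => i; rewrite mxE.
by apply/eqP; rewrite -sqrf_eq0 expr2 uu0.
Qed.

HB.instance Definition _ := isDotProduct.Build R _ (@dotcv R n) dotcv_gt0.

End DotInstance.

Definition norm2 (R : rcfType) (n : nat) (u : 'cV[R]_n) : R :=
  Num.sqrt (dotcv u u).

(* MathComp's [kermx] is the kernel of [u |-> u *m M] on row vectors; here
   matrices act on column vectors. *)
Definition kercv (R : fieldType) (m n : nat) (M : 'M[R]_(m, n)) :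
    {vspace 'cV[R]_n} :=
  lker (linfun (mulmx M : 'cV[R]_n -> 'cV[R]_m)).

Definition orthcv (R : realFieldType) (n : nat) (U : {vspace 'cV[R]_n}) :
    {vspace 'cV[R]_n} :=
  orthov (@dotcv R n : {dot 'cV[R]_n for idfun}) U.

(* [daddv_pi U V] is the projection onto [U] along [V] only when [U] and [V]
   are complementary; see [cap_orthcv] and [add_orthcv]. *)
Definition orthoproj (R : realFieldType) (n : nat) (U : {vspace 'cV[R]_n}) :
    'End('cV[R]_n) :=
  daddv_pi U (orthcv U).

Lemma mem_kercv (R : fieldType) (m n : nat) (M : 'M[R]_(m, n)) (u : 'cV[R]_n) :
  (u \in kercv M) = (M *m u == 0).
Proof. by rewrite memv_ker lfunE. Qed.

Lemma mem_orthcvP (R : realFieldType) (n : nat) (U : {vspace 'cV[R]_n})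
    (v : 'cV[R]_n) :
  reflect (forall u, u \in U -> dotcv v u = 0) (v \in orthcv U).
Proof. exact: mem_orthovP. Qed.

Section OrthogonalProjection.
Variables (R : realFieldType) (n : nat) (U : {vspace 'cV[R]_n}).

Lemma cap_orthcv : (U :&: orthcv U = 0)%VS.
Proof.
apply/eqP; rewrite -subv0; apply/subvP => u /memv_capP[uU /mem_orthcvP uO].
rewrite memv0; apply: contraT => /dotcv_gt0.
by rewrite uO // ltxx.
Qed.

Lemma add_orthcv : (U + orthcv U = fullv)%VS.
Proof.
apply/eqP; rewrite eqEdim subvf /= dimv_disjoint_sum ?cap_orthcv //.
pose f (v : 'cV[R]_n) : 'rV[R]_(\dim U) := \row_i dotcv v (vbasis U)`_i.
have flin : linear f.
  move=> a u v; apply/rowP => i; rewrite !mxE.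
  by rewrite (dotcv_bilinear R n).1.
pose fM := GRing.isLinear.Build R _ _ _ f flin.
pose fL : {linear 'cV[R]_n -> 'rV[R]_(\dim U)} := HB.pack f fM.
have sub : (lker (linfun fL) <= orthcv U)%VS.
  apply/subvP => v; rewrite memv_ker lfunE /= => /eqP/rowP fv0.
  apply/mem_orthcvP => u /coord_vbasis ->.
  rewrite /dotcv; under eq_bigr do rewrite summxE mulr_sumr.
  rewrite exchange_big big1 //= => j _; have := fv0 j; rewrite !mxE => v0.
  under eq_bigr do rewrite mxE mulrCA.
  by rewrite -mulr_sumr [X in _ * X]v0 mulr0.
have := limg_ker_dim (linfun fL) fullv; rewrite capfv => <-.
rewrite addnC leq_add ?dimvS //.
by apply: leq_trans (dimvS (subvf _)) _; rewrite dimvf /dim /= mul1n.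
Qed.

Lemma orthoproj_mem (s : 'cV[R]_n) : orthoproj U s \in U.
Proof. exact: memv_pi. Qed.

Lemma sub_orthoproj_mem (s : 'cV[R]_n) : s - orthoproj U s \in orthcv U.
Proof.
have sE : orthoproj U s + daddv_pi (orthcv U) U s = s.
  by apply: daddv_pi_add; rewrite ?cap_orthcv // add_orthcv memvf.
by rewrite -{1}sE addrC addKr memv_pi.
Qed.

Lemma orthoproj_unique (s p : 'cV[R]_n) :
  p \in U -> s - p \in orthcv U -> p = orthoproj U s.
Proof.
move=> pU spO; apply/eqP; rewrite -subr_eq0 -memv0 -cap_orthcv memv_cap.
rewrite rpredB ?orthoproj_mem //=.
have -> : p - orthoproj U s = (s - orthoproj U s) - (s - p).
  by rewrite opprB [RHS]addrC addrA subrK.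
by rewrite rpredB ?sub_orthoproj_mem.
Qed.

End OrthogonalProjection.

(* Main.v *)
(** Write [s = st + k] with [k] in the bi-orthogonal of the kernel, which is the
    kernel itself. Dropping [k] leaves [(B - A) s] unchanged and lowers
    [|s|^2 = |st|^2 + |k|^2], strictly unless [k = 0]; as [(B - A) st <> 0], the
    quotient then strictly increases. *)
Require Import Defs.
From mathcomp Require Import all_boot all_order all_algebra reals.
Set Implicit Arguments.
Unset Strict Implicit.
Unset Printing Implicit Defensive.
Import Order.TTheory GRing.Theory Num.Theory.
Local Open Scope ring_scope.

Lemma dotcvC (R : realFieldType) (n : nat) (u v : 'cV[R]_n) :
  dotcv u v = dotcv v u.
Proof. by apply: eq_bigr => i _; rewrite mulrC. Qed.

Lemma dotcv_ge0 (R : realFieldType) (n : nat) (u : 'cV[R]_n) :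
  0 <= dotcv u u.
Proof. by apply: sumr_ge0 => i _; rewrite -expr2 sqr_ge0. Qed.

Lemma dotcv_eq0 (R : realFieldType) (n : nat) (u : 'cV[R]_n) :
  (dotcv u u == 0) = (u == 0).
Proof.
apply/eqP/eqP => [uu0 | ->].
  by apply/eqP; apply: contraT => /dotcv_gt0; rewrite uu0 ltxx.
by apply: big1 => i _; rewrite mxE mul0r.
Qed.

(** Pythagoras: the cross terms [dotcv u v] and [dotcv v u] agree by symmetry, so both vanish. *)
Lemma dotcvDD (R : realFieldType) (n : nat) (u v : 'cV[R]_n) :
  dotcv u v = 0 -> dotcv (u + v) (u + v) = dotcv u u + dotcv v v.
Proof.
move=> uv0; have -> : dotcv (u + v) (u + v)
    = dotcv u u + dotcv v v + (dotcv u v + dotcv v u).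
  rewrite /dotcv -!big_split /=; apply: eq_bigr => i _.
  by rewrite !mxE mulrDl !mulrDr addrACA [X in _ + X]addrC addrACA
             [X in _ + X]addrC.
by rewrite [dotcv v u]dotcvC uv0 !addr0.
Qed.

Lemma norm2_sqr (R : rcfType) (n : nat) (u : 'cV[R]_n) :
  norm2 u ^+ 2 = dotcv u u.
Proof. by rewrite sqr_sqrtr ?dotcv_ge0. Qed.

(** For [x] in the double complement, the residual [x - orthoproj U x] lies both in [orthcv U] and,
    since [U] is inside its double complement, in [orthcv (orthcv U)]; these meet only in zero. *)
Lemma orthcvK (R : realFieldType) (n : nat) (U : {vspace 'cV[R]_n}) :
  orthcv (orthcv U) = U.
Proof.
have sUO : (U <= orthcv (orthcv U))%VS.
  apply/subvP => u uU; apply/mem_orthcvP => v /mem_orthcvP vO.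
  by rewrite dotcvC vO.
apply/eqP; rewrite eqEsubv sUO andbT; apply/subvP => x xOO.
have pU := orthoproj_mem U x.
suff : x - orthoproj U x == 0 by rewrite subr_eq0 => /eqP ->.
rewrite -memv0 -(cap_orthcv (orthcv U)) memv_cap sub_orthoproj_mem /=.
by rewrite rpredB // (subvP sUO).
Qed.

Theorem theorem3p21 (R : realType) (n : nat) (A B : 'M[R]_n)
    (s st : 'cV[R]_n)
    (hst : st = orthoproj (orthcv (kercv (B - A))) s)
    (st_neq0 : st <> 0) :
  norm2 ((B - A) *m s) ^+ 2 / norm2 s ^+ 2
    <= norm2 ((B - A) *m st) ^+ 2 / norm2 st ^+ 2
  /\
  (norm2 ((B - A) *m s) ^+ 2 / norm2 s ^+ 2
    = norm2 ((B - A) *m st) ^+ 2 / norm2 st ^+ 2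
   <-> s \in orthcv (kercv (B - A))).
Proof.
set M := B - A in hst *; set U := orthcv (kercv M) in hst *.
have stU : st \in U by rewrite hst orthoproj_mem.
pose k := s - st.
have kO : k \in orthcv U by rewrite /k hst sub_orthoproj_mem.
have sE : s = st + k by rewrite /k addrC subrK.
have Mk0 : M *m k = 0.
  by apply/eqP; rewrite -mem_kercv -[kercv M]orthcvK.
have st_gt0 : 0 < dotcv st st by apply: dotcv_gt0; apply/eqP.
(* Were [st] in the kernel, it would also lie in the orthogonal complement of the kernel, hence be
   zero. *)
have Mst_gt0 : 0 < dotcv (M *m st) (M *m st).
  apply: dotcv_gt0; rewrite -mem_kercv; apply/negP => stK.
  by apply: st_neq0; apply/eqP; rewrite -memv0 -(cap_orthcv (kercv M)) memv_cap stK.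
have stk0 : dotcv st k = 0 by rewrite dotcvC; move/mem_orthcvP: kO; apply.
have ssE : dotcv s s = dotcv st st + dotcv k k by rewrite sE dotcvDD.
(* So [s] is nonzero as well, and the left quotient is not a division by zero. *)
have ss_gt0 : 0 < dotcv s s by rewrite ssE ltr_wpDr ?dotcv_ge0.
have MsE : M *m s = M *m st by rewrite sE mulmxDr Mk0 addr0.
have k0E : (k == 0) = (s \in U).
  apply/eqP/idP => [k0 | sU]; first by rewrite sE k0 addr0.
  (* With [s] in [U], the difference [k = s - st] is both in [U] and orthogonal to it. *)
  apply/eqP; rewrite -memv0 -(cap_orthcv U) memv_cap kO andbT.
  by rewrite rpredB.
rewrite !norm2_sqr MsE; split.
  (* Both numerators are now the same positive number, so only the denominators are compared. *)
  by rewrite ler_pM2l // lef_pV2 ?posrE // ssE lerDl dotcv_ge0.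
(* Cancelling the nonzero numerator leaves [dotcv s s = dotcv st st], which by [ssE] means
   [dotcv k k = 0]. *)
rewrite -k0E -dotcv_eq0; split=> [/(mulfI (lt0r_neq0 Mst_gt0))/invr_inj | /eqP k0].
  by rewrite ssE => /eqP; rewrite addrC -subr_eq0 addrK.
by rewrite ssE k0 addr0.
Qed.
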